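(* Let $\tau$ be a preorder on an $n$-element set $E$. Then the preorder polytope $\mathcal{Q}_\tau$ is an $n$-dimensional lattice polytope in $\mathbb{R}^E$ which is unimodularly equivalent to a generalized permutohedron.
   Context: A preorder on a finite set $E$ is a reflexive and transitive relation $\le$ on $E$. An order ideal of $\tau$ is a subset $\mathcal{I}\subseteq E$ such that $b\in\mathcal{I}$ and $a\le b$ imply $a\in\mathcal{I}$. The preorder polytope $\mathcal{Q}_\tau\subset\mathbb{R}^E$ is defined by the inequalities $x_e\ge 0$ for all $e\in E$ and $\sum_{e\in\mathcal{I}} x_e\le|\mathcal{I}|$ for every order ideal $\mathcal{I}$ of $\tau$. A generalized permutohedron in $\mathbb{R}^F$ (in the sense of Postnikov) is a polytope of the form $\{(x_f)\in\mathbb{R}^F : \sum_{f\in F}x_f=z_F,\ \sum_{f\in I}x_f\ge z_I \text{ for all nonempty } I\subseteq F\}$ for some collection of reals $(z_I)$ indexed by nonempty subsets of $F$. *)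

(* Defs.v *)
From HB Require Import structures.
From mathcomp Require Import all_boot all_order all_algebra.
From mathcomp Require Import boolp classical_sets functions reals.

Set Implicit Arguments.
Unset Strict Implicit.
Unset Printing Implicit Defensive.

Import Order.TTheory GRing.Theory Num.Theory.

Local Open Scope classical_set_scope.
Local Open Scope ring_scope.

(* R^E, as a vector space over R; [R^o] is R seen as a module over itself. *)
Definition coord_space (R : realType) (E : finType) : vectType R :=
  {ffun E -> R^o}.

Section ConvexGeometry.
Variables (R : realType) (V : vectType R).
Implicit Type A : set V.

Definition affine_hull A : set V :=
  [set x | exists (k : nat) (p : 'I_k -> V) (w : 'I_k -> R),
     [/\ forall i, A (p i), \sum_(i < k) w i = 1
       & x = \sum_(i < k) w i *: p i]].

Definition convex_hull A : set V :=
  [set x | exists (k : nat) (p : 'I_k -> V) (w : 'I_k -> R),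
     [/\ forall i, A (p i), forall i, 0 <= w i, \sum_(i < k) w i = 1
       & x = \sum_(i < k) w i *: p i]].

(* The affine hull of A is a translate of a d-dimensional linear subspace. *)
Definition has_dimension A (d : nat) : Prop :=
  exists (p : V) (U : {vspace V}),
    affine_hull A = [set p + u | u in [set u | u \in U]] /\ \dim U = d.

End ConvexGeometry.

Definition lattice_points (R : realType) (E : finType) :
    set (coord_space R E) :=
  [set x : coord_space R E | forall e, (x e : R) \is a Num.int].

Arguments lattice_points R E : clear implicits.

Definition lattice_polytope (R : realType) (E : finType)
    (P : set (coord_space R E)) : Prop :=
  exists s : seq (coord_space R E),
    (forall x, x \in s -> lattice_points R E x) /\
    P = convex_hull [set x | x \in s].

(* The two polytopes may live in ambient spaces of different dimensions: the
   affine isomorphism and the lattices are those of the affine hulls. Every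
   affine map between affine hulls extends to the ambient spaces, so the map
   can be taken of the form x |-> f x + b with f linear on the whole space. *)
Definition unimodularly_equivalent (R : realType) (E F : finType)
    (P : set (coord_space R E)) (Q : set (coord_space R F)) : Prop :=
  exists (f : {linear coord_space R E -> coord_space R F})
         (b : coord_space R F),
    let phi x := f x + b in
    [/\ set_bij (affine_hull P) (affine_hull Q) phi,
        phi @` (affine_hull P `&` lattice_points R E) =
          affine_hull Q `&` lattice_points R F
      & phi @` P = Q].

Definition order_ideal (E : finType) (tau : rel E) (I : {set E}) : Prop :=
  forall a b, b \in I -> tau a b -> a \in I.

Definition preorder_polytope (R : realType) (E : finType) (tau : rel E) :
    set (coord_space R E) :=
  [set x : coord_space R E | (forall e, 0 <= (x e : R)) /\
     forall I : {set E}, order_ideal tau I ->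
       \sum_(e in I) (x e : R) <= #|I|%:R].

Arguments preorder_polytope R {E} tau.

(* [F] is nonempty because [z] is indexed by nonempty subsets and [z_F] must
   make sense; the value of [z] at the empty set is then never used. *)
Definition generalized_permutohedron (R : realType) (F : finType)
    (P : set (coord_space R F)) : Prop :=
  (0 < #|F|)%N /\
  exists z : {set F} -> R,
    P = [set x : coord_space R F |
           \sum_(f : F) (x f : R) = z [set: F]%SET /\
           forall I : {set F}, I != finset.set0 ->
             z I <= \sum_(f in I) (x f : R)].

(* Main.v *)
Require Import Defs.
From HB Require Import structures.
From mathcomp Require Import all_boot all_order all_algebra.
From mathcomp Require Import boolp classical_sets functions reals.
From mathcomp Require Import ring lra.

Set Implicit Arguments.
Unset Strict Implicit.
Unset Printing Implicit Defensive.

Import Order.TTheory GRing.Theory Num.Theory.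

Local Open Scope classical_set_scope.
Local Open Scope ring_scope.

(** Since order ideals are closed under union and intersection and cardinality
    is modular, the ideals tight at a point [x] of the polytope are closed under
    intersection. If [x] has a fractional coordinate, either some fractional
    [e] lies in no tight ideal, or a minimal tight ideal meeting the fractional
    coordinates contains two of them, [e] and [f]. Moving along the unit vector
    of [e], resp. along the difference of those of [e] and [f], in both
    directions until a new constraint becomes tight writes [x] as a convex
    combination of points with more tight constraints; hence the polytope is the
    convex hull of its lattice points. It contains the origin and the unit
    vectors, so it is full-dimensional. Finally, [x |-> (x, - sum x)] maps it
    onto the generalized permutohedron in one more coordinate whose [z_I] is
    [0] for [I] in [E], and minus the size of the ideal generated by the
    complement of [I] otherwise. *)

(** * Convex hulls and polyhedra spanned by special points *)

Lemma convex_hull_sub (R : realType) (V : vectType R) (A : set V) :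
  A `<=` convex_hull A.
Proof.
move=> x Ax; exists 1%N, (fun=> x), (fun=> 1); split=> //.
- by rewrite big_ord1.
- by rewrite big_ord1 scale1r.
Qed.

Lemma convex_hull_convex (R : realType) (V : vectType R) (A : set V)
    (x y : V) (a b : R) :
    convex_hull A x -> convex_hull A y -> 0 <= a -> 0 <= b -> a + b = 1 ->
  convex_hull A (a *: x + b *: y).
Proof.
move=> [k [p [u [Ap u0 u1 ->]]]] [l [q [v [Aq v0 v1 ->]]]] a0 b0 ab1.
pose pq (s : 'I_k + 'I_l) := match s with inl i => p i | inr j => q j end.
pose uv (s : 'I_k + 'I_l) :=
  match s with inl i => a * u i | inr j => b * v j end.
exists (k + l)%N, (pq \o @fintype.split k l), (uv \o @fintype.split k l); split.
- by move=> i /=; case: (fintype.split i).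
- by move=> i /=; case: (fintype.split i) => j /=; rewrite mulr_ge0.
- rewrite big_split_ord /=.
  under eq_bigr do rewrite (unsplitK (inl _)) /=.
  under [X in _ + X]eq_bigr do rewrite (unsplitK (inr _)) /=.
  by rewrite -!mulr_sumr u1 v1 !mulr1.
- rewrite big_split_ord /=.
  under [in RHS]eq_bigr do rewrite (unsplitK (inl _)) /= -scalerA.
  under [X in _ = _ + X]eq_bigr do rewrite (unsplitK (inr _)) /= -scalerA.
  by rewrite -!scaler_sumr.
Qed.

(** Ratio test: [s] holds the slacks of a point and [d] their rates of change along a direction. The
    step [t] is the least ratio [s c / - d c] over the decreasing slacks, so none becomes negative
    and a minimizer vanishes. Slacks already zero have rate zero and stay zero. *)
Lemma first_vanishing_slack (R : realType) (C : finType) (s d : C -> R) :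
    (forall c, 0 <= s c) -> (forall c, s c = 0 -> d c = 0) ->
    (exists c, d c < 0) ->
  exists t, [/\ 0 < t, forall c, 0 <= s c + t * d c
    & (#|[pred c | (s c + t * d c != 0)%R]| < #|[pred c | (s c != 0)%R]|)%N].
Proof.
move=> s0 sd [c0 dc0].
case: (@Order.TotalTheory.arg_minP _ _ _ c0 [pred c | d c < 0]
  (fun c => s c / - d c)) => //= c1 dc1 minc1.
have sc1 : 0 < s c1.
  by rewrite lt_neqAle s0 andbT eq_sym; apply/eqP => /sd E; rewrite E ltxx in dc1.
exists (s c1 / - d c1); split.
- by rewrite divr_gt0 // oppr_gt0.
- move=> c; have [dc|dc] := ltP (d c) 0.
    have := minc1 c dc; rewrite ler_pdivlMr ?oppr_gt0 // => h; lra.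
  by rewrite addr_ge0 // mulr_ge0 // divr_ge0 // ltW // oppr_gt0.
- apply: proper_card; apply/fintype.properP; split.
    apply/fintype.subsetP => c; rewrite !inE; apply: contraNneq => h.
    by rewrite h (sd _ h) mulr0 addr0.
  exists c1; rewrite !inE; first by rewrite gt_eqF.
  by rewrite negbK invrN mulrN mulNr divfK ?subrr // lt_eqF.
Qed.

(** Induction on the number of nonzero slacks: a point outside [S] lies between the two points where
    motion along [d] and [- d] first kills a slack. A decreasing and an increasing constraint ensure
    that both motions stop. *)
Lemma polyhedron_sub_convex_hull (R : realType) (V : vectType R) (C : finType)
    (b : C -> R) (l : C -> {scalar V}) (S : set V) :
    let P := [set x | forall c, 0 <= b c + l c x] in
    (forall x, P x -> ~ S x -> exists d,
      [/\ forall c, b c + l c x = 0 -> l c d = 0,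
          exists c, l c d < 0 & exists c, 0 < l c d]) ->
  P `<=` convex_hull (P `&` S).
Proof.
move=> P dirP x.
have [m] := ubnP #|[pred c | b c + l c x != 0]|.
elim: m x => // m IH x; rewrite ltnS => xm Px.
have [Sx|/(dirP _ Px) [d [tight neg [c cpos]]]] := pselect (S x).
  exact: convex_hull_sub.
have [t [t0 Pt lt_t]] := first_vanishing_slack Px tight neg.
have tightN c' : b c' + l c' x = 0 -> - l c' d = 0.
  by move=> /tight ->; rewrite oppr0.
have negN : exists c', - l c' d < 0 by exists c; rewrite oppr_lt0.
have [u [u0 Pu lt_u]] := first_vanishing_slack Px tightN negN.
have lE c' (r : R) : b c' + l c' x + r * l c' d = b c' + l c' (x + r *: d).
  by rewrite linearD linearZ addrA.
have lNE c' (r : R) : b c' + l c' x + r * - l c' d = b c' + l c' (x + - r *: d).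
  by rewrite linearD linearZ addrA /= mulrN mulNr.
have tu0 : 0 < t + u by rewrite addr_gt0.
have tun : t + u != 0 by rewrite gt_eqF.
(* The weights are chosen so that the displacements [t *: d] and [- u *: d] cancel. *)
have -> : x = (u / (t + u)) *: (x + t *: d) + (t / (t + u)) *: (x + - u *: d).
  rewrite !scalerDr addrACA -scalerDl !scalerA -scalerDl.
  have -> : u / (t + u) + t / (t + u) = 1 by field.
  have -> : u / (t + u) * t + t / (t + u) * - u = 0 by field.
  by rewrite scale1r scale0r addr0.
apply: convex_hull_convex.
- apply: IH; last by move=> c'; rewrite -lE.
  apply: leq_trans xm; apply: leq_ltn_trans lt_t.
  by rewrite subset_leq_card //; apply/fintype.subsetP => c'; rewrite !inE lE.
- apply: IH; last by move=> c'; rewrite -lNE.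
  apply: leq_trans xm; apply: leq_ltn_trans lt_u.
  by rewrite subset_leq_card //; apply/fintype.subsetP => c'; rewrite !inE lNE.
- by rewrite divr_ge0 // ltW.
- by rewrite divr_ge0 // ltW.
- by field.
Qed.

(** * Affine hulls and unit vectors *)

Lemma affine_hull_image (R : realType) (V W : vectType R)
    (f : {linear V -> W}) (b : W) (A : set V) :
  affine_hull [set f x + b | x in A] = [set f x + b | x in affine_hull A].
Proof.
(* As the weights sum to 1, the translation [b] comes out exactly once. *)
have fE k (p : 'I_k -> V) (w : 'I_k -> R) : \sum_(i < k) w i = 1 ->
    \sum_(i < k) w i *: (f (p i) + b) = f (\sum_(i < k) w i *: p i) + b.
  move=> w1; under eq_bigr do rewrite scalerDr.
  rewrite big_split /= -scaler_suml w1 scale1r linear_sum.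
  by congr (_ + _); apply: eq_bigr => i _; rewrite linearZ.
apply/seteqP; split=> y.
  move=> [k [q [w [Aq w1 ->]]]].
  have /choice[p Ap] : forall i, exists x, A x /\ f x + b = q i.
    by move=> i; have [x Ax <-] := Aq i; exists x.
  exists (\sum_(i < k) w i *: p i).
    by exists k, p, w; split=> // i; case: (Ap i).
  by rewrite -fE //; apply: eq_bigr => i _; case: (Ap i) => _ ->.
move=> [x [k [p [w [Ap w1 ->]]]] <-].
exists k, (fun i => f (p i) + b), w; split=> [i|//|]; last by rewrite fE.
by exists (p i).
Qed.

Definition unit_vector (R : realType) (E : finType) (e : E) :
  coord_space R E := [ffun k => (k == e)%:R].
Arguments unit_vector R {E} e.

Lemma sum_unit_vector (R : realType) (E : finType) (e : E) (I : {set E}) :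
  \sum_(k in I) (unit_vector R e k : R) = (e \in I)%:R.
Proof.
under eq_bigr do rewrite ffunE.
have [eI|eI] := boolP (e \in I).
  rewrite (bigD1 e) //= eqxx big1 ?addr0 // => k /andP[_ /negbTE ->].
  by [].
by rewrite big1 // => k kI; case: eqP => // ke; rewrite -ke kI in eI.
Qed.

Lemma coord_space_decomposition (R : realType) (E : finType)
    (x : coord_space R E) : x = \sum_e (x e : R) *: unit_vector R e.
Proof.
apply/ffunP => k; rewrite sum_ffunE (bigD1 k) //= big1 ?addr0.
  by rewrite !ffunE eqxx; rewrite /GRing.scale /= mulr1.
by move=> e ek; rewrite !ffunE eq_sym (negbTE ek) scaler0.
Qed.

Lemma dim_coord_space (R : realType) (E : finType) :
  \dim {: coord_space R E} = #|E|.
Proof. by rewrite dimvf /dim /= muln1. Qed.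

Lemma affine_hull_unit_vectors (R : realType) (E : finType)
    (A : set (coord_space R E)) :
  A 0 -> (forall e, A (unit_vector R e)) -> affine_hull A = setT.
Proof.
move=> A0 Ae; apply/seteqP; split=> // x _.
(* Index 0 is the origin, which absorbs the weight left over by the coordinates of [x]; the other
   indices enumerate the unit vectors. *)
pose p (i : 'I_#|E|.+1) :=
  if unlift ord0 i is Some j then unit_vector R (enum_val j) else 0.
pose w (i : 'I_#|E|.+1) : R :=
  if unlift ord0 i is Some j then x (enum_val j) else 1 - \sum_e (x e : R).
exists #|E|.+1, p, w; split.
- by move=> i; rewrite /p; case: (unlift _ _).
- rewrite big_ord_recl /w unlift_none.
  under [X in _ + X]eq_bigr do rewrite liftK.
  by rewrite -(big_enum_val (fun e => x e : R)) /= subrK.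
- rewrite big_ord_recl /w /p unlift_none scaler0 add0r.
  under eq_bigr do rewrite liftK.
  rewrite -(big_enum_val (fun e => (x e : R) *: unit_vector R e)).
  exact: coord_space_decomposition.
Qed.

(** * Generated ideals and the polytope as a finite system of inequalities *)

Definition down_closure (E : finType) (tau : rel E) (S : {set E}) : {set E} :=
  [set a | [exists b in S, tau a b]].

Lemma down_closure_ideal (E : finType) (tau : rel E) (S : {set E}) :
  transitive tau -> order_ideal tau (down_closure tau S).
Proof.
move=> tr a b; rewrite !inE => /exists_inP[c cS bc] ab.
by apply/exists_inP; exists c => //; apply: tr bc.
Qed.

Lemma sub_down_closure (E : finType) (tau : rel E) (S : {set E}) :
  reflexive tau -> S \subset down_closure tau S.
Proof.
by move=> re; apply/fintype.subsetP => a aS; rewrite inE; apply/exists_inP; exists a.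
Qed.

Lemma down_closure_id (E : finType) (tau : rel E) (S : {set E}) :
  reflexive tau -> order_ideal tau S -> down_closure tau S = S.
Proof.
move=> re idS; apply/eqP; rewrite finset.eqEsubset sub_down_closure // andbT.
by apply/fintype.subsetP => a; rewrite inE => /exists_inP[b bS] /(idS _ _ bS).
Qed.

(** Constraints are indexed by the finite type [E + {set E}]: an arbitrary subset stands for the
    ideal it generates, so every ideal occurs, possibly several times, and being an ideal need not
    be decided. *)
Definition slack_constant (R : realType) (E : finType) (tau : rel E)
    (c : E + {set E}) : R :=
  match c with inl _ => 0 | inr J => #|down_closure tau J|%:R end.

Definition slack_linear (R : realType) (E : finType) (tau : rel E)
    (c : E + {set E}) (x : coord_space R E) : R :=
  match c with
  | inl e => x e
  | inr J => - \sum_(e in down_closure tau J) (x e : R)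
  end.

Lemma slack_linear_is_linear (R : realType) (E : finType) (tau : rel E)
    (c : E + {set E}) : scalar (@slack_linear R E tau c).
Proof.
move=> a x y; case: c => [e|S] /=; first by rewrite !ffunE.
under eq_bigr do rewrite !ffunE.
by rewrite big_split /= -mulr_sumr opprD mulrN.
Qed.

HB.instance Definition _ (R : realType) (E : finType) (tau : rel E)
    (c : E + {set E}) :=
  GRing.isLinear.Build R (coord_space R E) R *%R (@slack_linear R E tau c)
    (@slack_linear_is_linear R E tau c).

Lemma preorder_polytopeE (R : realType) (E : finType) (tau : rel E) :
    reflexive tau -> transitive tau ->
  preorder_polytope R tau =
  [set x | forall c, 0 <= slack_constant R tau c + slack_linear tau c x].
Proof.
move=> re tr; apply/seteqP; split=> x.
  move=> [x0 xI] [e|S] /=; first by rewrite add0r.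
  by rewrite subr_ge0; apply/xI/down_closure_ideal.
move=> /= slackx; split=> [e|I idI]; first by have := slackx (inl e); rewrite /= add0r.
by have := slackx (inr I); rewrite /= down_closure_id // subr_ge0.
Qed.

(** * Tight ideals and fractional coordinates *)

Lemma order_idealI (E : finType) (tau : rel E) (S T : {set E}) :
  order_ideal tau S -> order_ideal tau T -> order_ideal tau (S :&: T).
Proof.
move=> iS iT a b; rewrite !inE => /andP[bS bT] ab.
by rewrite (iS _ _ bS ab) (iT _ _ bT ab).
Qed.

Lemma order_idealU (E : finType) (tau : rel E) (S T : {set E}) :
  order_ideal tau S -> order_ideal tau T -> order_ideal tau (S :|: T).
Proof.
move=> iS iT a b; rewrite !inE => /orP[bS|bT] ab.
  by rewrite (iS _ _ bS ab).
by rewrite (iT _ _ bT ab) orbT.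
Qed.

Definition tight_ideal (R : realType) (E : finType) (tau : rel E)
    (x : coord_space R E) (I : {set E}) : Prop :=
  order_ideal tau I /\ \sum_(e in I) (x e : R) = #|I|%:R.

Lemma sum_setUI (M : nmodType) (E : finType) (F : E -> M) (S T : {set E}) :
  \sum_(e in S :|: T) F e + \sum_(e in S :&: T) F e =
  \sum_(e in S) F e + \sum_(e in T) F e.
Proof.
rewrite [in LHS](big_setID S) /= [\sum_(e in T) _](big_setID S) /=.
rewrite finset.setUK -addrA; congr (_ + _); rewrite addrC (finset.setIC T).
by congr (_ + _); apply: eq_bigl => e; rewrite !inE; case: (e \in S).
Qed.

(** Uncrossing: coordinate sums and cardinality are both modular, so the upper bound for the union
    forces the matching lower bound for the intersection. *)
Lemma tight_idealI (R : realType) (E : finType) (tau : rel E)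
    (x : coord_space R E) (S T : {set E}) :
    preorder_polytope R tau x -> tight_ideal tau x S -> tight_ideal tau x T ->
  tight_ideal tau x (S :&: T).
Proof.
move=> [_ xI] [iS xS] [iT xT]; have iST := order_idealI iS iT.
split=> //; apply/eqP; rewrite eq_le xI //=.
have := sum_setUI (fun e => x e : R) S T.
have := xI _ (order_idealU iS iT).
have := cardsUI S T => /(congr1 (fun k => k%:R : R)); rewrite !natrD.
rewrite xS xT; lra.
Qed.

(* A tight ideal has an integral total, so it cannot contain exactly one
   fractional coordinate. *)
Lemma fractional_direction (R : realType) (E : finType) (tau : rel E)
    (x : coord_space R E) :
    preorder_polytope R tau x -> ~ lattice_points R E x ->
  (exists2 e, (x e : R) \isn't a Num.int
     & forall I, tight_ideal tau x I -> e \notin I) \/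
  (exists e f, [/\ e != f, (x e : R) \isn't a Num.int,
     (x f : R) \isn't a Num.int
     & forall I, tight_ideal tau x I -> (e \in I) = (f \in I)]).
Proof.
move=> Qx /existsNP[e0 /negP xe0].
pose bad (I : {set E}) := `[< tight_ideal tau x I >] &&
  [exists e in I, (x e : R) \isn't a Num.int].
have badP I e : tight_ideal tau x I -> e \in I -> (x e : R) \isn't a Num.int ->
    bad I.
  by move=> tI eI xe; apply/andP; split; [exact/asboolP|apply/exists_inP; exists e].
have [I0 badI0|nobad] := pickP bad; last first.
  left; exists e0 => // I tI; apply/negP => e0I.
  by have := badP _ _ tI e0I xe0; rewrite nobad.
(* [T] has least cardinality among the tight ideals containing a fractional coordinate. *)
right; have [T /andP[/asboolP tT /exists_inP[e eT xe]] minT] :=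
  arg_minnP (fun I : {set E} => #|I|) badI0.
have [f fT [fe xf]] : exists2 f, f \in T & f != e /\ (x f : R) \isn't a Num.int.
  apply: contrapT => nof; move/negP: xe; apply.
  have := tT.2; rewrite (bigD1 e) //= => /(canRL (addrK _)) ->.
  rewrite rpredB ?natr_int // rpred_sum // => f /andP[fT fe].
  by apply: contrapT => /negP xf; apply: nof; exists f.
exists e, f; split=> //; first by rewrite eq_sym.
(* If [I] contains a fractional [g] of [T], then [I :&: T] is again tight and contains [g], so
   minimality makes it equal to [T]. Applied to [e] and [f], this shows that a tight ideal contains
   both or neither. *)
have sub I g : tight_ideal tau x I -> g \in T -> (x g : R) \isn't a Num.int ->
    g \in I -> T \subset I.
  move=> tI gT xg gI; have tIT := tight_idealI Qx tI tT.
  have /minT cT : bad (I :&: T) by apply: badP xg => //; rewrite inE gI.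
  have /eqP <- : I :&: T == T by rewrite eqEcard finset.subsetIr.
  exact: finset.subsetIl.
move=> I tI; apply/idP/idP.
  by move=> /(sub _ _ tI eT xe)/fintype.subsetP; apply.
by move=> /(sub _ _ tI fT xf)/fintype.subsetP; apply.
Qed.

(** * Integrality of the polytope *)

Lemma preorder_polytope_sub_hull (R : realType) (E : finType) (tau : rel E) :
    reflexive tau -> transitive tau ->
  preorder_polytope R tau `<=`
  convex_hull (preorder_polytope R tau `&` lattice_points R E).
Proof.
move=> re tr; rewrite preorder_polytopeE //.
apply: (@polyhedron_sub_convex_hull R (coord_space R E) _
  (slack_constant R tau) (fun c => @slack_linear R E tau c)) => x Px Lx.
have Qx : preorder_polytope R tau x by rewrite preorder_polytopeE.
have tight S : #|down_closure tau S|%:R -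
    \sum_(e in down_closure tau S) (x e : R) = 0 ->
    tight_ideal tau x (down_closure tau S).
  by move=> /subr0_eq h; split; [exact: down_closure_ideal|rewrite h].
have nonint e : (x e : R) \isn't a Num.int -> (0 + (x e : R) = 0) -> False.
  by rewrite add0r => /negP + h; rewrite h; apply; exact: rpred0.
have full : down_closure tau [set: E] = [set: E]%SET.
  by apply/eqP; rewrite finset.eqEsubset finset.subsetT sub_down_closure.
have [[e xe eI]|[e [f [ef xe xf efI]]]] := fractional_direction Qx Lx.
  (* A tight coordinate is 0, hence differs from the fractional [e], and no tight ideal contains
     [e]. The ideal of all of [E] stops the increase of [x e]. *)
  exists (unit_vector R e); split.
  - move=> [k|S] /=.
      by move=> h; rewrite ffunE; case: eqP => // ke; case: (nonint e xe); rewrite -ke.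
    by move=> /tight/eI/negbTE h; rewrite sum_unit_vector h oppr0.
  - by exists (inr [set: E]%SET) => /=; rewrite sum_unit_vector full inE oppr_lt0 ltr01.
  - by exists (inl e) => /=; rewrite ffunE eqxx ltr01.
(* Every tight ideal contains both or neither of [e] and [f], so its total is preserved;
   nonnegativity at [f] and at [e] stops the two motions. *)
exists (unit_vector R e - unit_vector R f); split.
- move=> [k|S] /=.
    move=> h; rewrite !ffunE; case: eqP => [ke|_].
      by case: (nonint e) => //; rewrite -ke.
    case: eqP => [kf|_]; last by rewrite subr0.
    by case: (nonint f) => //; rewrite -kf.
  move=> /tight/efI h; under eq_bigr do rewrite ffunE [X in _ + X]ffunE.
  by rewrite big_split /= sumrN !sum_unit_vector h subrr oppr0.
- exists (inl f) => /=.
  by rewrite !ffunE eqxx eq_sym (negbTE ef) sub0r oppr_lt0 ltr01.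
- by exists (inl e) => /=; rewrite !ffunE eqxx (negbTE ef) subr0 ltr01.
Qed.

Lemma preorder_polytope_convex_hull (R : realType) (E : finType) (tau : rel E)
    (A : set (coord_space R E)) :
  A `<=` preorder_polytope R tau -> convex_hull A `<=` preorder_polytope R tau.
Proof.
move=> AQ x [k [p [w [Ap w0 w1 ->]]]]; split=> [e|I iI].
  rewrite sum_ffunE sumr_ge0 // => i _; rewrite ffunE.
  by apply: mulr_ge0 => //; case: (AQ _ (Ap i)).
under eq_bigr => e _.
  rewrite sum_ffunE; under eq_bigr do rewrite ffunE.
  over.
rewrite exchange_big /= -[leRHS]mul1r -[X in X * _]w1 mulr_suml ler_sum // => i _.
by rewrite -mulr_sumr ler_wpM2l //; apply: (AQ _ (Ap i)).2.
Qed.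

Lemma preorder_polytope_lattice (R : realType) (E : finType) (tau : rel E) :
    reflexive tau -> transitive tau ->
  lattice_polytope (preorder_polytope R tau).
Proof.
move=> re tr; pose Q := preorder_polytope R tau.
(* The ideal of all of [E] bounds each coordinate by [#|E|], so these finitely many functions reach
   every lattice point of the polytope. *)
pose pt (h : {ffun E -> 'I_#|E|.+1}) : coord_space R E :=
  [ffun e => (h e : nat)%:R].
pose s := [seq pt h | h in [pred h | `[< Q (pt h) >]]].
exists s; split.
  by move=> _ /mapP[h _ ->] e; rewrite ffunE natr_int.
have -> : [set x | x \in s] = Q `&` lattice_points R E.
  apply/seteqP; split=> x.
    move=> /mapP[h]; rewrite mem_enum => /asboolP Qh ->; split=> //.
    by move=> e; rewrite ffunE natr_int.
  move=> [Qx Lx].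
  have xle e : (x e : R) <= #|E|%:R.
    rewrite -cardsT; apply: le_trans (Qx.2 [set: E]%SET _) => //.
    by rewrite (bigD1 e) //= lerDl sumr_ge0 // => f _; exact: Qx.1.
  pose h : {ffun E -> 'I_#|E|.+1} := [ffun e => inord (Num.truncn (x e : R))].
  have hx : pt h = x.
    apply/ffunP => e; rewrite !ffunE.
    have /natrP[m xm] : (x e : R) \is a Num.nat by rewrite natrEint Lx Qx.1.
    have := xle e; rewrite xm ler_nat natrK => mE.
    by rewrite inordK.
  by rewrite -hx; apply: map_f; rewrite mem_enum; apply/asboolP; rewrite hx.
apply/seteqP; split; first exact: preorder_polytope_sub_hull.
by apply: preorder_polytope_convex_hull => x [].
Qed.

(** * Full dimension *)

Lemma affine_hull_preorder_polytope (R : realType) (E : finType) (tau : rel E) :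
  affine_hull (preorder_polytope R tau) = setT.
Proof.
apply: affine_hull_unit_vectors.
  split=> [e|I _]; first by rewrite ffunE.
  by rewrite big1 // => e _; rewrite ffunE.
move=> e; split=> [k|I _]; first by rewrite ffunE ler0n.
by rewrite sum_unit_vector ler_nat; case: (boolP (e \in I)) => // eI; rewrite (cardD1 e) eI.
Qed.

Lemma preorder_polytope_dimension (R : realType) (E : finType) (tau : rel E) :
  has_dimension (preorder_polytope R tau) #|E|.
Proof.
exists 0, fullv; split; last exact: dim_coord_space.
rewrite affine_hull_preorder_polytope; apply/seteqP; split=> // x _.
by exists x; rewrite ?add0r //= memvf.
Qed.

(** * The generalized permutohedron *)

(** The coordinate [None] is fixed by requiring total 0, which places [R^E] as a hyperplane in one
    more dimension. *)
Definition homogenize (R : realType) (E : finType) (x : coord_space R E) :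
    coord_space R (option E) :=
  [ffun o => if o is Some e then x e else - \sum_e (x e : R)].

Lemma homogenize_is_linear (R : realType) (E : finType) :
  linear (@homogenize R E).
Proof.
move=> a x y; apply/ffunP => -[e|]; rewrite !ffunE //.
under eq_bigr do rewrite !ffunE.
by rewrite big_split /= -mulr_sumr opprD -mulrN.
Qed.

HB.instance Definition _ (R : realType) (E : finType) :=
  GRing.isLinear.Build R (coord_space R E) (coord_space R (option E)) *:%R
    (@homogenize R E) (@homogenize_is_linear R E).

Lemma homogenize_inj (R : realType) (E : finType) : injective (@homogenize R E).
Proof.
by move=> x y /ffunP xy; apply/ffunP => e; have := xy (Some e); rewrite !ffunE.
Qed.

Lemma homogenize_lattice (R : realType) (E : finType) (x : coord_space R E) :
  lattice_points R (option E) (homogenize x) <-> lattice_points R E x.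
Proof.
split=> [Lx e|Lx [e|]]; first by have := Lx (Some e); rewrite ffunE.
  by rewrite ffunE; exact: Lx.
by rewrite ffunE rpredN rpred_sum // => e _; exact: Lx.
Qed.

Lemma sum_option (M : zmodType) (E : finType) (F : option E -> M)
    (I : {set option E}) :
  \sum_(o in I) F o =
  F None *+ (None \in I) + \sum_(e in [set e | Some e \in I]%SET) F (Some e).
Proof.
rewrite big_mkcond (bigD1 None) //= -mulrb; congr (_ + _).
rewrite (reindex_omap Some id) => [|[]//]; rewrite [RHS]big_mkcond.
by apply: eq_big => e; rewrite ?eqxx ?inE.
Qed.

(** The total is 0, so a subset containing [None] sums to minus its complement, which lies in
    [E]. *)
Lemma sum_homogenize (R : realType) (E : finType) (x : coord_space R E)
    (I : {set option E}) :
  \sum_(o in I) (homogenize x o : R) =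
  if None \in I then - \sum_(e in [set e | Some e \notin I]%SET) (x e : R)
  else \sum_(e in [set e | Some e \in I]%SET) (x e : R).
Proof.
rewrite sum_option ffunE; under [X in _ + X]eq_bigr do rewrite ffunE.
case: (None \in I); last by rewrite add0r.
rewrite mulr1n (bigID (mem [set e | Some e \in I]%SET)) /= opprD addrAC addNr add0r.
by congr (- _); apply: eq_bigl => e; rewrite !inE.
Qed.

Lemma homogenize_preorder_polytope (R : realType) (E : finType) (tau : rel E) :
    reflexive tau -> transitive tau ->
  generalized_permutohedron [set homogenize x | x in preorder_polytope R tau].
Proof.
move=> re tr; split; first by rewrite card_option.
pose z (I : {set option E}) : R :=
  if None \in I then - #|down_closure tau [set e | Some e \notin I]%SET|%:R else 0.
have sumT (y : coord_space R (option E)) :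
    \sum_o (y o : R) = \sum_(o in [set: option E]%SET) (y o : R).
  by apply: eq_bigl => o; rewrite inE.
have zT : z [set: option E]%SET = 0.
  rewrite /z inE (_ : down_closure _ _ = finset.set0) ?cards0 ?oppr0 //.
  apply/setP => a; rewrite !inE; apply/negbTE/exists_inPn => b.
  by rewrite !inE.
exists z; apply/seteqP; split=> y.
  move=> [x [x0 xI] <-]; split=> [|I _].
    rewrite zT sumT sum_homogenize inE big1 ?oppr0 // => e.
    by rewrite !inE.
  rewrite sum_homogenize /z; case: ifP => _; last first.
    by rewrite sumr_ge0 // => e _; exact: x0.
  (* By nonnegativity, enlarging the complement of [I] to the ideal it generates only increases the
     sum, and the ideal inequality bounds that. *)
  rewrite lerN2; apply: le_trans _ (xI _ (@down_closure_ideal _ _ _ tr)).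
  rewrite [leRHS](bigID (mem [set e | Some e \notin I]%SET)) /=.
  rewrite [in leRHS](eq_bigl (mem [set e | Some e \notin I]%SET)).
    by rewrite lerDl sumr_ge0 // => e _; exact: x0.
  move=> e; rewrite andb_idl //.
  exact: (fintype.subsetP (sub_down_closure _ re)).
move=> [ysum yI]; pose x : coord_space R E := [ffun e => y (Some e)].
(* Since [z] vanishes on the full set, [y] has total 0, which determines its [None] coordinate. *)
have hx : homogenize x = y.
  apply/ffunP => -[e|]; rewrite !ffunE //.
  move: ysum; rewrite zT sumT sum_option inE mulr1n => /eqP; rewrite addr_eq0 => /eqP ->.
  congr (- _); apply: eq_big => e; rewrite ?inE //.
  by rewrite ffunE.
exists x => //; split=> [e|J iJ].
  rewrite ffunE; have := yI [set Some e]%SET; rewrite big_set1 /z inE /=; apply.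
  by apply/set0Pn; exists (Some e); rewrite inE.
(* The complement of [I] is the ideal [J], its own down-closure, so the bound [z I] is exactly the
   inequality for [J]. Nonnegativity came from singletons. *)
pose I := [set o : option E | if o is Some e then e \notin J else true]%SET.
have NI : None \in I by rewrite inE.
have IJ : [set e | Some e \notin I]%SET = J.
  by apply/setP => e; rewrite !inE negbK.
have /yI : I != finset.set0 by apply/set0Pn; exists None.
by rewrite -hx sum_homogenize /z NI IJ down_closure_id // lerN2.
Qed.

(** Taking affine hulls commutes with the injective map [homogenize], and the added coordinate is an
    integer whenever the others are, so lattice points correspond both ways. *)
Lemma unimodularly_equivalent_homogenize (R : realType) (E : finType)
    (P : set (coord_space R E)) :
  unimodularly_equivalent P [set homogenize x | x in P].
Proof.
exists (@homogenize R E), 0 => /=.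
have hE : (fun x => homogenize x + 0) = @homogenize R E.
  by apply/funext => x; rewrite addr0.
have aff := affine_hull_image (@homogenize R E) 0 P.
rewrite /= hE in aff *; rewrite aff; split=> //.
  split=> [x Px|x y _ _ /homogenize_inj //|//].
  by exists x.
apply/seteqP; split=> y.
  by move=> [x [Px Lx] <-]; split; [exists x|exact/homogenize_lattice].
by move=> [[x Px <-] /homogenize_lattice Lx]; exists x.
Qed.

Theorem theorem1p4 (R : realType) (n : nat) (E : finType) (cardE : #|E| = n)
    (tau : rel E) (tau_refl : reflexive tau) (tau_trans : transitive tau) :
  [/\ lattice_polytope (preorder_polytope R tau),
      has_dimension (preorder_polytope R tau) n
    & exists (F : finType) (P : set (coord_space R F)),
        generalized_permutohedron P /\
        unimodularly_equivalent (preorder_polytope R tau) P].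
Proof.
split; first exact: preorder_polytope_lattice.
  by rewrite -cardE; exact: preorder_polytope_dimension.
exists (option E), [set homogenize x | x in preorder_polytope R tau].
by split; [exact: homogenize_preorder_polytope
          |exact: unimodularly_equivalent_homogenize].
Qed.
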